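(* Let $S=\mathrm{diag}(s_1,s_2,s_3)$ with $0<s_1<s_2<s_3$ and $s_1+s_2+s_3=1$. Let $T=\mathrm{diag}(t_1,t_2,t_3)\in\mathcal T^2(S)$ have distinct eigenvalues, let $$(\lambda_1,\lambda_2)=\left(\tfrac{t_1}{s_2},\tfrac{t_2}{s_2}\right)\ \text{if } T \text{ satisfies condition (a)},\qquad (\lambda_1,\lambda_2)=\left(\tfrac{t_3}{s_2},\tfrac{t_2}{s_2}\right)\ \text{if } T\text{ satisfies condition (b)},$$ and let $R_1,R_2\in SO(3)$ and a unit vector $n\in\mathbb R^3$ be such that $$R_1^tTR_1=\lambda_1S+(1-\lambda_1)\,n\otimes n,\qquad R_2^tTR_2=\lambda_2S+(1-\lambda_2)\,n\otimes n .$$ Then there exist $C>0$ and $\bar r>2$ such that for each $A$ in the open segment $(\lambda_1S,R_1^tTR_1)$ there exists a sequence of laminates of finite order $\nu_k\in\mathcal L(\mathbb M^{3\times3})$, $k\in\mathbb N$, satisfying (i) the barycenter of $\nu_k$ is $A$ for all $k\in\mathbb N$; (ii) $\nu_k(\mathbb M^{3\times3}\setminus K(S))\to0$ as $k\to+\infty$; (iii) $\displaystyle\int_{\mathbb M^{3\times3}}|F|^r\,d\nu_k(F)<C$ for all $k\in\mathbb N$ and all $r\in[1,\bar r)$.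
   Context: $\mathbb M^{3\times3}$ is the space of real $3\times3$ matrices, and $$K(S)=\{\lambda R^tSR:\lambda\in\mathbb R,\ R\in SO(3)\}.$$ **The set $\mathcal T^2(S)$.** Let $$F(x,y)=\frac{s_1s_3}{s_2}\cdot\frac{xy}{x^2+xy+y^2-s_2(x+y)},\qquad (x,y)\in[s_1,s_3]^2$$ (an equation involving $F(x,y)$ is understood to require that the denominator be nonzero). For $T=\mathrm{diag}(t_1,t_2,t_3)$ with $s_1\le t_1\le t_2\le t_3\le s_3$ and $t_1+t_2+t_3=1$ put $$\alpha_-(T,S)=\max\left(\tfrac{t_1}{s_2},\tfrac{t_2}{s_3}\right),\quad \alpha_+(T,S)=\min\left(\tfrac{t_2}{s_2},\tfrac{t_3}{s_3}\right),\quad \beta_-(T,S)=\max\left(\tfrac{t_1}{s_1},\tfrac{t_2}{s_2}\right),\quad \beta_+(T,S)=\min\left(\tfrac{t_2}{s_1},\tfrac{t_3}{s_2}\right).$$ $\mathcal T^2(S)$ is the set of all such $T$ that satisfy either (a) $(\alpha_-(T,S),\alpha_+(T,S))=\left(\frac{t_1}{s_2},\frac{t_2}{s_2}\right)$ and $t_3=F(t_1,t_2)$, or (b) $(\beta_-(T,S),\beta_+(T,S))=\left(\frac{t_2}{s_2},\frac{t_3}{s_2}\right)$ and $t_1=F(t_3,t_2)$. **Laminates.** The barycenter of a finite signed Radon measure $\nu$ on $\mathbb M^{3\times3}$ is $\bar\nu=\int A\,d\nu(A)$. The family $\mathcal L(\mathbb M^{3\times3})$ of laminates of finite order is the smallest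 family of probability measures on $\mathbb M^{3\times3}$ such that: $\delta_A\in\mathcal L(\mathbb M^{3\times3})$ for every $A$; and if $\sum_{i=1}^N\mu_i\delta_{A_i}\in\mathcal L(\mathbb M^{3\times3})$ and $A_1=\mu B+(1-\mu)C$ with $\mu\in[0,1]$ and $\mathrm{rank}(B-C)=1$, then $\mu_1(\mu\delta_B+(1-\mu)\delta_C)+\sum_{i=2}^N\mu_i\delta_{A_i}\in\mathcal L(\mathbb M^{3\times3})$. *)

(* Defs.v *)
From HB Require Import structures.
From mathcomp Require Import all_boot all_order all_algebra.
From mathcomp Require Import all_classical all_reals all_analysis.

Set Implicit Arguments.
Unset Strict Implicit.
Unset Printing Implicit Defensive.

Import Order.TTheory GRing.Theory Num.Theory.
Import numFieldNormedType.Exports.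
Local Open Scope classical_set_scope.
Local Open Scope ring_scope.

(* The type of real 3 x 3 matrices with its Borel sigma-algebra. *)
Notation borelM3 R := (g_sigma_algebraType (@open 'M[R]_3)).

Section MatrixNotions.
Variable R : realType.

(* The Euclidean (Frobenius) norm, and not the sup norm that [`|A|] denotes. *)
Definition normF m n (A : 'M[R]_(m, n)) : R :=
  Num.sqrt (\sum_(i < m) \sum_(j < n) A i j ^+ 2).

Definition diag3 (a b c : R) : 'M[R]_3 :=
  diag_mx (\row_(i < 3) [:: a; b; c]`_i).

Definition SO3 : set 'M[R]_3 := [set Q | Q^T *m Q = 1%:M /\ \det Q = 1].

Definition K (S : 'M[R]_3) : set 'M[R]_3 :=
  [set A | exists l : R, exists2 Q, SO3 Q & A = l *: (Q^T *m S *m Q)].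

Definition otimes (u v : 'cV[R]_3) : 'M[R]_3 := u *m v^T.

Definition open_segment (A B : 'M[R]_3) : set 'M[R]_3 :=
  [set D | exists2 t : R, 0 < t < 1 & D = (1 - t) *: A + t *: B].

Definition distinct_eigenvalues (A : 'M[R]_3) : Prop :=
  exists2 e : 'I_3 -> R, injective e & forall i, eigenvalue A (e i).

End MatrixNotions.

Section T2.
Variables (R : realType) (s1 s2 s3 : R).

Definition Fden (x y : R) : R := x ^+ 2 + x * y + y ^+ 2 - s2 * (x + y).

Definition F (x y : R) : R := (s1 * s3) / s2 * (x * y / Fden x y).

(* [z = F(x, y)], including the requirement that the fraction be defined. *)
Definition eqF (z x y : R) : Prop := Fden x y != 0 /\ z = F x y.

Variables t1 t2 t3 : R.

Definition alpha_minus : R := Num.max (t1 / s2) (t2 / s3).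
Definition alpha_plus : R := Num.min (t2 / s2) (t3 / s3).
Definition beta_minus : R := Num.max (t1 / s1) (t2 / s2).
Definition beta_plus : R := Num.min (t2 / s1) (t3 / s2).

Definition T2_a : Prop :=
  (alpha_minus, alpha_plus) = (t1 / s2, t2 / s2) /\ eqF t3 t1 t2.

Definition T2_b : Prop :=
  (beta_minus, beta_plus) = (t2 / s2, t3 / s2) /\ eqF t1 t3 t2.

End T2.

(* The set T^2(S) for S = diag(s1, s2, s3). *)
Definition T2 (R : realType) (s1 s2 s3 : R) : set 'M[R]_3 :=
  [set T | exists t1 t2 t3 : R,
    [/\ T = diag3 t1 t2 t3,
        [/\ s1 <= t1, t1 <= t2, t2 <= t3 & t3 <= s3],
        t1 + t2 + t3 = 1 &
        T2_a s1 s2 s3 t1 t2 t3 \/ T2_b s1 s2 s3 t1 t2 t3]].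

Section Laminates.
Variable R : realType.
Implicit Types nu : probability (borelM3 R) R.

(* The entrywise integral of the identity. *)
Definition barycenter nu : 'M[R]_3 :=
  \matrix_(i, j) (\int[nu]_A (A : 'M[R]_3) i j)%R.

(* [nu = \sum_i w i * \d_(A i)] with nonnegative weights. Library measures are
   total functions on sets, whose values outside the sigma-algebra carry no
   information: equality of measures is equality on measurable sets. *)
Definition is_atomic nu N (w : 'I_N -> R) (A : 'I_N -> borelM3 R) : Prop :=
  (forall i, 0 <= w i) /\
  (forall X : set (borelM3 R), measurable X ->
    nu X = (\sum_(i < N) (w i)%:E * \d_(A i) X)%E).

Inductive laminate : probability (borelM3 R) R -> Prop :=
| laminate_dirac nu (A : borelM3 R) :
    (forall X : set (borelM3 R), measurable X -> nu X = \d_A X) ->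
    laminate nu
| laminate_split nu nu' N (w : 'I_N.+1 -> R) (A : 'I_N.+1 -> borelM3 R)
    (mu : R) (B C : 'M[R]_3) :
    laminate nu ->
    is_atomic nu w A ->
    0 <= mu <= 1 ->
    A ord0 = mu *: B + (1 - mu) *: C ->
    \rank (B - C) = 1%N ->
    (forall X : set (borelM3 R), measurable X ->
      nu' X = ((w ord0)%:E *
                 (mu%:E * \d_(B : borelM3 R) X +
                  (1 - mu)%:E * \d_(C : borelM3 R) X) +
               \sum_(i < N) (w (lift ord0 i))%:E * \d_(A (lift ord0 i)) X)%E) ->
    laminate nu'.

End Laminates.

(* Main.v *)
(* T is rank-one connected along the same direction n (x) n to both l1 S and l2 S,
   up to rotations. Conjugating the second connection, each rotated copy of T
   lies on a rank-one segment from a rotation of l2 S to a rotation of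
   (l2 / l1) T, the latter having weight p = (1 - l2) l1 / ((1 - l1) l2) < 1.
   Iterating this staircase leaves only mass O(p^k) outside K(S), located on a
   rotation of (l2 / l1)^k T. The r-th moments are thus dominated by a geometric
   series of ratio p max(1, l2 / l1)^r, and p (l2 / l1)^2 < 1 leaves room for
   exponents r slightly above 2. *)

Require Import Defs.
From HB Require Import structures.
From mathcomp Require Import all_boot all_order all_algebra.
From mathcomp Require Import all_classical all_reals all_analysis.
From mathcomp Require Import measurable_realfun ring lra.

Set Implicit Arguments.
Unset Strict Implicit.
Unset Printing Implicit Defensive.

Import Order.TTheory GRing.Theory Num.Theory.
Import numFieldNormedType.Exports.
Local Open Scope classical_set_scope.
Local Open Scope ring_scope.

(** * Finitely supported probability measures and their integrals *)

Section AtomicMeasures.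
Context d (T : measurableType d) (R : realType).
Implicit Types (w : nat -> R) (A : nat -> T) (N : nat).

Let atomic w (w0 : forall i, 0 <= w i) A N : {measure set T -> \bar R} :=
  msum (fun i => mscale (NngNum (w0 i)) \d_(A i)) N.

(** The formula is kept for all sets, measurable or not, so that it can later be evaluated on the
    complement of [K S]. *)
Lemma atomic_probability w A N :
  (forall i, 0 <= w i) -> \sum_(i < N) w i = 1 ->
  exists P : probability T R,
    forall X, P X = (\sum_(i < N) (w i)%:E * \d_(A i) X)%E.
Proof.
move=> w0 w1; pose m := atomic w0 A N.
have m1 : m [set: T] = 1%E.
  rewrite -w1 -sumEFin; apply: eq_bigr => i _.
  by rewrite /= /mscale /= diracT mule1.
pose M := Measure_isProbability.Build _ _ _ m m1.
pose P : probability T R := HB.pack (Measure.sort m) M.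
by exists P.
Qed.

(** Additivity in the measure is used for nonnegative integrands only; as [f] has no sign, it is
    split into its positive and negative parts. *)
Lemma integral_atomic (P : {measure set T -> \bar R}) w A N (f : T -> R) :
    (forall i, 0 <= w i) ->
    (forall X, measurable X -> P X = (\sum_(i < N) (w i)%:E * \d_(A i) X)%E) ->
    measurable_fun [set: T] f ->
  (\int[P]_x (f x)%:E = (\sum_(i < N) w i * f (A i))%:E)%E.
Proof.
move=> w0 PE mf.
have -> : (\int[P]_x (f x)%:E = \int[atomic w0 A N]_x (f x)%:E)%E.
  by apply: eq_measure_integral => X mX _; rewrite PE.
have ge0E (g : T -> R) : measurable_fun [set: T] g -> (forall x, 0 <= g x) ->
    (\int[atomic w0 A N]_x (g x)%:E = (\sum_(i < N) w i * g (A i))%:E)%E.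
  move=> /measurable_EFinP mg g0.
  rewrite ge0_integral_measure_sum// -?sumEFin; last by move=> x _; rewrite lee_fin.
  apply: eq_bigr => i _; rewrite ge0_integral_mscale// ?integral_dirac//.
    by rewrite diracT mul1e EFinM.
  by move=> x _; rewrite lee_fin.
rewrite integralE.
rewrite -[fun x => (f x)%:E]/(EFin \o f) funerpos funerneg.
rewrite (ge0E _ (measurable_funrpos mf) (funrpos_ge0 f)).
rewrite (ge0E _ (measurable_funrneg mf) (funrneg_ge0 f)).
rewrite -EFinB -sumrB; congr EFin; apply: eq_bigr => i _.
by rewrite -mulrBr; congr (_ * _); exact: (congr1 (@^~ (A i)) (funrposBneg f)).
Qed.

End AtomicMeasures.

(** * Borel measurability of matrix entries and of the Euclidean norm *)

Section BorelMatrices.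
Context (R : realType).

Lemma measurable_coord (i j : 'I_3) :
  measurable_fun [set: borelM3 R] (fun A : borelM3 R => (A : 'M[R]_3) i j).
Proof.
apply: (measurability _ (RGenOpens.measurableE R)) => _ [_ [a [b ->]] <-].
rewrite setTI; apply: sub_sigma_algebra.
apply: open_comp; last exact: interval_open.
by move=> x _; exact: coord_continuous.
Qed.

Lemma measurable_normF :
  measurable_fun [set: borelM3 R] (fun A : borelM3 R => normF (A : 'M[R]_3)).
Proof.
apply: (@measurableT_comp _ _ _ _ _ _ (@Num.sqrt R)).
  by apply: continuous_measurable_fun; exact: sqrt_continuous.
apply: measurable_sum => i; apply: measurable_sum => j.
by apply: measurable_funX; exact: measurable_coord.
Qed.

End BorelMatrices.

(** * Iterated splitting of a single atom *)

Section Staircase.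
Context (R : realType) (p t : R) (P : 'M[R]_3) (X Y : nat -> 'M[R]_3).
Hypotheses (p01 : 0 <= p <= 1) (t01 : 0 <= t <= 1).
Hypothesis XE : forall k, X k = p *: X k.+1 + (1 - p) *: Y k.

(* After [k] splittings only the atom [X k], of weight [t * p ^+ k], is left to
   be split further; it is listed first because [laminate_split] acts on it. *)
Definition stair_point k (i : nat) : borelM3 R :=
  match i with 0 => X k | 1 => P | m.+2 => Y m end.

Definition stair_weight k (i : nat) : R :=
  match i with
  | 0 => t * p ^+ k | 1 => 1 - t | m.+2 => t * p ^+ m * (1 - p)
  end.

Lemma stair_weight_ge0 k i : 0 <= stair_weight k i.
Proof.
have [/andP[p0 p1] /andP[t0 t1]] := (p01, t01).
by case: i => [|[|m]] /=; rewrite ?mulr_ge0 ?exprn_ge0 ?subr_ge0.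
Qed.

Lemma stair_sumE k (f : borelM3 R -> R) :
  \sum_(i < k.+2) stair_weight k i * f (stair_point k i) =
  t * p ^+ k * f (X k) + (1 - t) * f P +
  \sum_(j < k) t * p ^+ j * (1 - p) * f (Y j).
Proof. by rewrite !big_ord_recl addrA. Qed.

(** Each splitting preserves the weighted sum of such an [f]. A constant [f] gives the total mass, a
    matrix entry gives the barycenter. *)
Lemma stair_sum_affine k (f : borelM3 R -> R) :
  (forall j, f (X j) = p * f (X j.+1) + (1 - p) * f (Y j)) ->
  \sum_(i < k.+2) stair_weight k i * f (stair_point k i) =
  t * f (X 0%N) + (1 - t) * f P.
Proof.
move=> fE; rewrite stair_sumE; elim: k => [|k <-].
  by rewrite big_ord0 expr0; ring.
by rewrite big_ord_recr /= (fE k) exprS; ring.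
Qed.

(** The bound is uniform in [k]: the atoms [X k] and [P] cost at most [m] each, and the atoms [Y j]
    are dominated by a geometric series of ratio [p * q]. *)
Lemma stair_sum_le k (f : borelM3 R -> R) (m q : R) :
    0 <= m -> 0 <= q -> p * q < 1 ->
    f P <= m -> (forall j, f (X j) <= m * q ^+ j) ->
    (forall j, f (Y j) <= m * q ^+ j) ->
  \sum_(i < k.+2) stair_weight k i * f (stair_point k i) <=
  m * (2 + (1 - p * q)^-1).
Proof.
have [/andP[p0 p1] /andP[t0 t1]] := (p01, t01).
move=> m0 q0 pq1 fP fX fY; have pq0 : 0 <= p * q by rewrite mulr_ge0.
have geo : \sum_(j < k) (p * q) ^+ j <= (1 - p * q)^-1.
  rewrite -[leRHS]mul1r ler_pdivlMr ?subr_gt0// mulrC -opprB mulNr -subrX1.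
  by rewrite opprB gerBl exprn_ge0.
rewrite stair_sumE [leRHS](_ : _ = m + m + m * (1 - p * q)^-1); last by ring.
apply: lerD; first apply: lerD.
- apply: le_trans (_ : t * p ^+ k * (m * q ^+ k) <= _).
    by rewrite ler_wpM2l// mulr_ge0// exprn_ge0.
  rewrite mulrACA -exprMn -[leRHS]mulr1 ler_pM ?mulr_ge0 ?exprn_ge0//.
    by rewrite ler_piMl.
  by rewrite exprn_ile1// ltW.
- apply: le_trans (_ : (1 - t) * m <= _); first by rewrite ler_wpM2l ?subr_ge0.
  by rewrite ler_piMl// gerBl.
apply: le_trans (_ : m * \sum_(j < k) (p * q) ^+ j <= _); last by rewrite ler_wpM2l.
rewrite mulr_sumr; apply: ler_sum => j _.
apply: le_trans (_ : t * p ^+ j * (1 - p) * (m * q ^+ j) <= _).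
  by rewrite ler_wpM2l// !mulr_ge0 ?exprn_ge0 ?subr_ge0.
rewrite [leLHS](_ : _ = t * (1 - p) * (m * (p * q) ^+ j)); last by rewrite exprMn; ring.
rewrite ler_piMl ?mulr_ge0 ?exprn_ge0// mulr_ile1 ?subr_ge0//.
by rewrite gerBl.
Qed.

Hypothesis rankXP : \rank (X 0%N - P) = 1%N.
Hypothesis rankXY : forall k, \rank (X k.+1 - Y k) = 1%N.

Lemma staircase_laminates : exists nu : nat -> probability (borelM3 R) R,
  (forall k, laminate (nu k)) /\
  (forall k Z, nu k Z =
     (\sum_(i < k.+2) (stair_weight k i)%:E * \d_(stair_point k i) Z)%E).
Proof.
have w1 k : \sum_(i < k.+2) stair_weight k i = 1.
  have := stair_sum_affine k (f := fun=> 1); under eq_bigr do rewrite mulr1.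
  by move=> -> => [|_]; ring.
have [nu nuE] := choice (fun k =>
  atomic_probability (stair_point k) (stair_weight_ge0 k) (w1 k)).
exists nu; split=> // k; elim: k => [|k IHk].
  (* The first measure arises by splitting the Dirac mass at the barycenter. *)
  pose A : borelM3 R := t *: X 0%N + (1 - t) *: P.
  apply: (@laminate_split _ \d_A _ 0 (fun=> 1) (fun=> A) t (X 0%N) P) => //.
  - exact: laminate_dirac.
  - by split=> // Z _; rewrite big_ord1 mul1e.
  - by move=> Z _; rewrite nuE !big_ord_recl !big_ord0 /= !adde0 mul1e mulr1.
apply: (@laminate_split _ (nu k) _ k.+1 (fun i => stair_weight k i)
  (fun i => stair_point k i) p (X k.+1) (Y k)) => //.
- by split=> [i|Z _]; [exact: stair_weight_ge0|exact: nuE].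
- exact: XE.
(* The new atom [Y k] is last in the list of stage [k.+1], whereas [laminate_split] puts it next to
   [X k.+1]; the sum is reordered accordingly. *)
move=> Z _; rewrite nuE big_ord_recl big_ord_recr /= exprSr mulrA.
rewrite ge0_muleDr ?mule_ge0 ?lee_fin ?subr_ge0//; [|by case/andP: p01..].
by rewrite !muleA -!EFinM addeA -addeA [X in (_ + X)%E]addeC addeA.
Qed.

End Staircase.

(** * Conjugation by rotations: rank and Euclidean norm *)

Section OrthogonalConjugation.
Context (R : realType).
Implicit Types A B V W : 'M[R]_3.

Lemma SO3_mulT V : SO3 V -> V *m V^T = 1%:M.
Proof. by case=> /mulmx1C. Qed.

Lemma SO3_1 : SO3 (1%:M : 'M[R]_3).
Proof. by split; rewrite ?trmx1 ?mulmx1 ?det1. Qed.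

Lemma SO3_mul V W : SO3 V -> SO3 W -> SO3 (V *m W).
Proof.
move=> [VV dV] [WW dW]; split; last by rewrite det_mulmx dV dW mulr1.
by rewrite trmx_mul mulmxA -(mulmxA W^T) VV mulmx1.
Qed.

Lemma SO3_tr V : SO3 V -> SO3 V^T.
Proof. by move=> VO; split; rewrite ?trmxK ?SO3_mulT// det_tr; case: VO. Qed.

Lemma conj_mul A V W :
  (V *m W)^T *m A *m (V *m W) = W^T *m (V^T *m A *m V) *m W.
Proof. by rewrite trmx_mul !mulmxA. Qed.

Lemma conj_comb A B W a b :
  W^T *m (a *: A + b *: B) *m W =
  a *: (W^T *m A *m W) + b *: (W^T *m B *m W).
Proof. by rewrite mulmxDr mulmxDl -!scalemxAr -!scalemxAl. Qed.

Lemma rank_conj A V c : SO3 V -> c != 0 -> \rank (c *: (V^T *m A *m V)) = \rank A.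
Proof.
move=> [VV _] c0; rewrite mxrank_scale_nz//.
have [uVT uV] := mulmx1_unit VV.
rewrite mxrankMfree ?row_free_unit// -mxrank_tr trmx_mul trmxK.
by rewrite mxrankMfree ?mxrank_tr// row_free_unit.
Qed.

(** The diagonal of [otimes n n] consists of the squared entries of [n], so the matrix cannot vanish
    for a unit vector. *)
Lemma rank_otimes_unit (n : 'cV[R]_3) : normF n = 1 -> \rank (otimes n n) = 1%N.
Proof.
move=> n1; apply/eqP; rewrite eqn_leq mulmx_max_rank lt0n mxrank_eq0.
apply: contra_eqN n1 => /eqP nn0; rewrite /normF.
under eq_bigr => i _ do rewrite big_ord1 expr2.
rewrite big1 ?sqrtr0 1?eq_sym ?oner_neq0// => i _.
by move/matrixP/(_ i i): nn0; rewrite !mxE big_ord1 mxE.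
Qed.

Lemma normF_ge0 A : 0 <= normF A. Proof. exact: sqrtr_ge0. Qed.

(** In trace form, invariance under conjugation by a rotation follows from cyclicity of the
    trace. *)
Lemma normF_tr A : normF A = Num.sqrt (\tr (A^T *m A)).
Proof.
rewrite /normF exchange_big; congr Num.sqrt; apply: eq_bigr => j _.
by rewrite mxE; apply: eq_bigr => i _; rewrite mxE expr2.
Qed.

Lemma normFZ A c : 0 <= c -> normF (c *: A) = c * normF A.
Proof.
move=> c0; rewrite !normF_tr [(c *: A)^T]linearZ /= -scalemxAl -scalemxAr scalerA mxtraceZ.
by rewrite sqrtrM ?mulr_ge0// -expr2 sqrtr_sqr ger0_norm.
Qed.

Lemma normF_conj A V : SO3 V -> normF (V^T *m A *m V) = normF A.
Proof.
move=> VO; rewrite !normF_tr !trmx_mul trmxK !mulmxA.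
rewrite -(mulmxA _ V V^T) SO3_mulT// mulmx1 mxtrace_mulC !mulmxA.
by rewrite SO3_mulT// mul1mx.
Qed.

End OrthogonalConjugation.

(** A strict inequality at exponent 2 survives slightly beyond 2; logarithms make the gain
    explicit. *)
Lemma growth_exponent (R : realType) (p q : R) : 0 <= p -> 0 < q ->
  p * q ^+ 2 < 1 -> exists2 r, 2 < r & p * q `^ r < 1.
Proof.
move=> p0 q0 pq; have [->|pN0] := eqVneq p 0.
  by exists 3; rewrite ?mul0r ?ltr01 ?ltr_nat.
have {pN0}p0 : 0 < p by rewrite lt_def pN0.
have pow r : p * q `^ r = expR (ln p + r * ln q).
  by rewrite expRD lnK ?posrE// /powR gt_eqF.
have expR_lt1 (x : R) : (expR x < 1) = (x < 0) by rewrite -[1 in LHS]expR0 ltr_expR.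
move: pq; rewrite -powR_mulrn ?ltW// pow expR_lt1 => lpq.
pose u := - (ln p + 2 * ln q); have u0 : 0 < u by rewrite oppr_gt0.
have v0 : 0 < `|ln q| + 1 by rewrite ltr_wpDl.
(* The increment times [ln q] stays below the slack [u]; the [+ 1] keeps the denominator positive
   and the comparison strict. *)
exists (2 + u / (`|ln q| + 1)); first by rewrite ltrDl divr_gt0.
rewrite pow expR_lt1 mulrDl addrA -[X in X + _]opprK -/u.
rewrite addrC subr_lt0 mulrAC ltr_pdivrMr// ltr_pM2l//.
by rewrite (le_lt_trans (ler_norm _))// ltrDl.
Qed.

(** * Diagonal matrices and the inequalities encoded in [T2] *)

Lemma eigenvalue_diag3 (R : realType) (a b c e : R) :
  eigenvalue (diag3 a b c) e -> [\/ e = a, e = b | e = c].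
Proof.
case/eigenvalueP => v /rowP vE /rV0Pn[i vi].
have := vE i; rewrite mul_mx_diag !mxE [RHS]mulrC => /(mulfI vi).
by case: i {vi} => -[|[|[]]] //= _ <-; [apply: Or31|apply: Or32|apply: Or33].
Qed.

(** If two neighbours agreed, three distinct eigenvalues would have to fit into two values. *)
Lemma distinct_eigenvalues_diag3 (R : realType) (a b c : R) :
  distinct_eigenvalues (diag3 a b c) -> a != b /\ b != c.
Proof.
case=> e e_inj /(_ _)/eigenvalue_diag3 eE.
pose o i : 'I_3 := inord i.
have o01 : e (o 0%N) <> e (o 1%N) by move/e_inj/(congr1 val); rewrite /= !inordK.
have o02 : e (o 0%N) <> e (o 2%N) by move/e_inj/(congr1 val); rewrite /= !inordK.
have o12 : e (o 1%N) <> e (o 2%N) by move/e_inj/(congr1 val); rewrite /= !inordK.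
have [[e0 e1] e2] := (eE (o 0%N), eE (o 1%N), eE (o 2%N)).
by split; apply/eqP => E; case: e0 => e0; case: e1 => e1; case: e2 => e2; congruence.
Qed.

(** Serves to identify the entries bound existentially in [T2] with the given ones. *)
Lemma diag3_inj (R : realType) (a b c a' b' c' : R) :
  diag3 a b c = diag3 a' b' c' -> [/\ a = a', b = b' & c = c'].
Proof.
move/matrixP => E; split.
- by have := E (inord 0) (inord 0); rewrite !mxE eqxx !inordK.
- by have := E (inord 1) (inord 1); rewrite !mxE eqxx !inordK.
- by have := E (inord 2) (inord 2); rewrite !mxE eqxx !inordK.
Qed.

(* In case (a), [p * (l2 / l1) ^+ 2 < 1] amounts to [l1 + l2 > 1]; in case (b)
   already [l2 / l1 < 1]. *)
Lemma T2_contraction (R : realType) (s1 s2 s3 t1 t2 t3 l1 l2 : R) :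
    0 < s1 -> s1 < s2 -> s2 < s3 ->
    T2 s1 s2 s3 (diag3 t1 t2 t3) -> distinct_eigenvalues (diag3 t1 t2 t3) ->
    (T2_a s1 s2 s3 t1 t2 t3 /\ (l1, l2) = (t1 / s2, t2 / s2)) \/
    (T2_b s1 s2 s3 t1 t2 t3 /\ (l1, l2) = (t3 / s2, t2 / s2)) ->
  let p := (1 - l2) * l1 / ((1 - l1) * l2) in
  [/\ 0 < l1, 0 < l2, l1 != 1, 0 <= p < 1 & p * (l2 / l1) ^+ 2 < 1].
Proof.
move=> s1_gt0 s12 s23 [t1' [t2' [t3' [/diag3_inj[<- <- <-] [st1 t12 t23 ts3] _ _]]]].
move=> /distinct_eigenvalues_diag3[t12N t23N] cases p.
have {t12 t12N}t12 : t1 < t2 by rewrite lt_def eq_sym t12N.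
have {t23 t23N}t23 : t2 < t3 by rewrite lt_def eq_sym t23N.
have t1_gt0 : 0 < t1 := lt_le_trans s1_gt0 st1.
have [t2_gt0 t3_gt0] : 0 < t2 /\ 0 < t3 by split; lra.
have [s2_gt0 s3_gt0] : 0 < s2 /\ 0 < s3 by split; lra.
case: cases => -[].
- move=> [[_ ap] [den t3F]] [l1E l2E].
  have t2s : t2 <= s2.
    have : t2 / s2 <= t3 / s3 by rewrite -ap ge_min lexx orbT.
    have : t3 / s3 <= 1 by rewrite ler_pdivrMr ?mul1r.
    by move=> /[swap]/le_trans/[apply]; rewrite ler_pdivrMr ?mul1r.
  (* The numerator in [t3F] is positive, so [t3 > 0] forces the sign of the denominator. *)
  have den_gt0 : 0 < Fden s2 t1 t2.
    rewrite -invr_gt0 -(pmulr_rgt0 _ (_ : 0 < s1 * s3 / s2 * (t1 * t2))).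
      by move: t3_gt0; rewrite t3F /F !mulrA.
    by rewrite !mulr_gt0 ?invr_gt0.
  (* The denominator is less than [(t1 + t2) ^+ 2 - s2 * (t1 + t2)]. *)
  have sum_gt : s2 < t1 + t2.
    rewrite -(ltr_pM2r (_ : 0 < t1 + t2)) ?addr_gt0// -subr_gt0.
    apply: lt_le_trans den_gt0 _; rewrite /Fden.
    have : 0 <= t1 * t2 by rewrite mulr_ge0 ?ltW.
    by nra.
  have l1_gt0 : 0 < l1 by rewrite l1E divr_gt0.
  have l2_gt0 : 0 < l2 by rewrite l2E divr_gt0.
  have l12 : l1 < l2 by rewrite l1E l2E ltr_pM2r ?invr_gt0.
  have l2_le1 : l2 <= 1 by rewrite l2E ler_pdivrMr ?mul1r.
  have l1_lt1 : l1 < 1 := lt_le_trans l12 l2_le1.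
  have lsum : 1 < l1 + l2 by rewrite l1E l2E -mulrDl ltr_pdivlMr ?mul1r.
  have d_gt0 : 0 < (1 - l1) * l2 by rewrite mulr_gt0 ?subr_gt0.
  have e_gt0 : 0 < (1 - l1) * l1 by rewrite mulr_gt0 ?subr_gt0.
  split=> //; first by rewrite lt_eqF.
    (* Once the denominator is cleared, [p < 1] is just [l1 < l2]. *)
    by rewrite /p ltr_pdivrMr// divr_ge0 ?(ltW d_gt0) ?mulr_ge0 ?subr_ge0 ?(ltW l1_gt0)//=; nra.
  have -> : p * (l2 / l1) ^+ 2 = (1 - l2) * l2 / ((1 - l1) * l1).
    by rewrite /p; field; rewrite !gt_eqF ?subr_gt0.
  rewrite ltr_pdivrMr// mul1r -subr_gt0.
  have -> : (1 - l1) * l1 - (1 - l2) * l2 = (l2 - l1) * (l1 + l2 - 1) by ring.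
  by rewrite mulr_gt0 ?subr_gt0.
- move=> [[bm _] _] [l1E l2E].
  have s2t : s2 <= t2.
    have : t1 / s1 <= t2 / s2 by rewrite -bm le_max lexx.
    have : 1 <= t1 / s1 by rewrite ler_pdivlMr ?mul1r.
    by move/le_trans/[apply]; rewrite ler_pdivlMr ?mul1r.
  have l1_gt0 : 0 < l1 by rewrite l1E divr_gt0.
  have l2_gt0 : 0 < l2 by rewrite l2E divr_gt0.
  have l21 : l2 < l1 by rewrite l1E l2E ltr_pM2r ?invr_gt0.
  have l2_ge1 : 1 <= l2 by rewrite l2E ler_pdivlMr ?mul1r.
  have l1_gt1 : 1 < l1 := le_lt_trans l2_ge1 l21.
  have d_gt0 : 0 < (l1 - 1) * l2 by rewrite mulr_gt0 ?subr_gt0.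
  (* Here [1 - l1 < 0] and [1 - l2 <= 0]; flipping both signs makes all factors nonnegative. *)
  have pE : p = (l2 - 1) * l1 / ((l1 - 1) * l2).
    rewrite /p; field; rewrite gt_eqF// gt_eqF ?subr_gt0//=.
    by rewrite lt_eqF ?subr_lt0.
  have p0 : 0 <= p by rewrite pE divr_ge0 ?(ltW d_gt0) ?mulr_ge0 ?subr_ge0 ?(ltW l1_gt0).
  have p1 : p < 1 by rewrite pE ltr_pdivrMr// mul1r; nra.
  split=> //; [by rewrite gt_eqF|by rewrite p0|].
  apply: le_lt_trans p1; rewrite ler_piMr// exprn_ile1// ?divr_ge0 ?ltW//.
  by rewrite ltr_pdivrMr ?mul1r.
Qed.

(** * Rotated copies of [T] and the resulting laminates *)

Theorem theorem4p5 (R : realType) (s1 s2 s3 t1 t2 t3 l1 l2 : R)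
    (S T R1 R2 : 'M[R]_3) (n : 'cV[R]_3)
    (hs : [/\ 0 < s1, s1 < s2 & s2 < s3])
    (hs1 : s1 + s2 + s3 = 1)
    (hS : S = diag3 s1 s2 s3)
    (hT : T = diag3 t1 t2 t3)
    (hT2 : T2 s1 s2 s3 T)
    (hTd : distinct_eigenvalues T)
    (hl : (T2_a s1 s2 s3 t1 t2 t3 /\ (l1, l2) = (t1 / s2, t2 / s2)) \/
          (T2_b s1 s2 s3 t1 t2 t3 /\ (l1, l2) = (t3 / s2, t2 / s2)))
    (hR1 : SO3 R1) (hR2 : SO3 R2) (hn : normF n = 1)
    (h1 : R1^T *m T *m R1 = l1 *: S + (1 - l1) *: otimes n n)
    (h2 : R2^T *m T *m R2 = l2 *: S + (1 - l2) *: otimes n n) :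
  exists C rbar : R, [/\ 0 < C, 2 < rbar &
    forall A : 'M[R]_3, open_segment (l1 *: S) (R1^T *m T *m R1) A ->
    exists nu : nat -> probability (borelM3 R) R,
      [/\ forall k, laminate (nu k),
          forall k, barycenter (nu k) = A,
          nu k (~` K S) @[k --> \oo] --> 0%E &
          forall k (r : R), 1 <= r < rbar ->
            (\int[nu k]_X ((normF (X : 'M[R]_3)) `^ r)%:E < C%:E)%E]].
Proof.
have [l1_gt0 l2_gt0 l1N1 p01 prho] : let p := (1 - l2) * l1 / ((1 - l1) * l2) in
    [/\ 0 < l1, 0 < l2, l1 != 1, 0 <= p < 1 & p * (l2 / l1) ^+ 2 < 1].
  by case: hs => s1_gt0 s12 s23; apply: (T2_contraction s1_gt0 s12 s23 _ _ hl); rewrite -hT.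
set p := _ / _ in p01 prho; set rho := l2 / l1 in prho.
have [p_ge0 p_lt1] := andP p01.
have rho_gt0 : 0 < rho by rewrite divr_gt0.
have l1B_neq0 : 1 - l1 != 0 by rewrite subr_eq0 eq_sym.
(* Bounding [rho] by some [q >= 1] allows exponents to be raised later; [p * q ^+ 2 < 1] still holds
   because [p < 1]. *)
pose q := Num.max 1 rho.
have q_gt0 : 0 < q by rewrite lt_max ltr01.
have [rbar rbar2 prbar] : exists2 r, 2 < r & p * q `^ r < 1.
  by apply: growth_exponent => //; rewrite /q; case: (leP 1 rho); rewrite ?expr1n ?mulr1.
(* The recursion gives [V k = R2 *m W k] and [V k.+1 = R1 *m W k]: [h2] at stage [k] and [h1] at
   stage [k.+1] are conjugated by the same [W k], hence share the direction [N k]. *)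
pose V := fix V k := if k is k'.+1 then R1 *m R2^T *m V k' else R1.
pose W k := R2^T *m V k.
have VO k : SO3 (V k).
  by elim: k => //= k IHk; do !apply: SO3_mul => //; exact: SO3_tr.
have WO k : SO3 (W k) by apply: SO3_mul => //; exact: SO3_tr.
pose X k := rho ^+ k *: ((V k)^T *m T *m V k).
pose Y k := (rho ^+ k * l2) *: ((W k)^T *m S *m W k).
pose N k := (W k)^T *m otimes n n *m W k.
(* The line through [Y k] and [X k.+1] is made of the [Y k + c *: N k] and contains [X k]. *)
have XE k : X k = Y k + (rho ^+ k * (1 - l2)) *: N k.
  rewrite /X /Y /N -!scalerA -scalerDr; congr (_ *: _).
  have -> : V k = R2 *m W k by rewrite mulmxA SO3_mulT// mul1mx.
  by rewrite conj_mul h2 conj_comb.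
have XSE k : X k.+1 = Y k + (rho ^+ k.+1 * (1 - l1)) *: N k.
  (* As [rho * l1 = l2], the multiple of [S] in [X k.+1] is the same as in [X k]. *)
  have -> : Y k = (rho ^+ k.+1 * l1) *: ((W k)^T *m S *m W k).
    by congr (_ *: _); rewrite exprSr -mulrA /rho divfK ?gt_eqF.
  rewrite /X /N -!scalerA -scalerDr; congr (_ *: _).
  have -> : V k.+1 = R1 *m W k by rewrite /= mulmxA.
  by rewrite conj_mul h1 conj_comb.
(* [p] is the quotient of the coefficients of [N k] in [XE] and [XSE]. *)
have Xsplit k : X k = p *: X k.+1 + (1 - p) *: Y k.
  rewrite XE XSE; apply/matrixP => i j; rewrite !mxE exprS /p /rho.
  by field; rewrite l1B_neq0 !gt_eqF.
have rankXY k : \rank (X k.+1 - Y k) = 1%N.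
  rewrite XSE addrC addKr rank_conj ?rank_otimes_unit//.
  by rewrite mulf_neq0// expf_neq0// gt_eqF.
have rankXP : \rank (X 0%N - l1 *: S) = 1%N.
  rewrite /X expr0 scale1r h1 addrC addKr.
  by rewrite mxrank_scale_nz ?rank_otimes_unit.
pose M := (l1 * normF S + normF T + l2 * normF S) + 1.
have l1S_ge0 : 0 <= l1 * normF S by rewrite mulr_ge0 ?normF_ge0 ?ltW.
have l2S_ge0 : 0 <= l2 * normF S by rewrite mulr_ge0 ?normF_ge0 ?ltW.
have T_ge0 : 0 <= normF T := normF_ge0 T.
have [M_ge1 l1S_le TM l2S_le] : [/\ 1 <= M, l1 * normF S <= M,
    normF T <= M & l2 * normF S <= M] by rewrite /M; split; lra.
(* This constant is fixed before [A], [k] and [r]; the final [+ 1] makes the moment bound strict. *)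
exists (M `^ rbar * (2 + (1 - p * q `^ rbar)^-1) + 1), rbar; split=> //.
  rewrite ltr_wpDl// mulr_ge0 ?powR_ge0// addr_ge0// invr_ge0 subr_ge0.
  exact: ltW.
move=> A [t t01 ->].
have {}t01 : 0 <= t <= 1 by case/andP: t01 => /ltW -> /ltW ->.
have p01' : 0 <= p <= 1 by rewrite p_ge0 ltW.
have [nu [nuL nuE]] := staircase_laminates p01' t01 Xsplit rankXP rankXY.
have intE k (f : borelM3 R -> R) : measurable_fun [set: borelM3 R] f ->
    (\int[nu k]_x (f x)%:E = (\sum_(i < k.+2) stair_weight p t k i *
       f (stair_point (l1 *: S) X Y k i))%:E)%E.
  by apply: integral_atomic => [i|Z _]; [exact: stair_weight_ge0|exact: nuE].
exists nu; split=> // [k||k r /andP[r1 rr]].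
- apply/matrixP => i j; rewrite !mxE /Rintegral intE; last exact: measurable_coord.
  rewrite /= (stair_sum_affine _ _ _ (f := fun B : 'M[R]_3 => B i j)).
    by rewrite /X expr0 scale1r !mxE addrC.
  by move=> m; rewrite [in LHS]Xsplit !mxE.
(* All atoms but the first lie in [K S], so the mass outside is at most [t * p ^+ k]. *)
- have PK i k : K S (stair_point (l1 *: S) X Y k i.+1).
    case: i => [|i] /=; last by exists (rho ^+ i * l2), (W i).
    exists l1, 1%:M; first exact: SO3_1.
    by rewrite trmx1 mul1mx mulmx1.
  apply: (@squeeze_cvge _ _ _ _ (cst 0%E) _ (fun k => (p ^+ k)%:E)).
  + apply: nearW => k; rewrite measure_ge0 nuE big_ord_recl big1 ?adde0 /=.
      rewrite -EFinM lee_fin mulrAC ler_piMl ?exprn_ge0// indicE.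
      by case/andP: t01; case: (_ \in _); rewrite ?mulr1 ?mulr0.
    by move=> i _; rewrite diracE memNset ?mule0//; apply; exact: PK.
  + exact: cvg_cst.
  + by apply: cvg_EFin; [exact: nearW|apply: cvg_expr; rewrite ger0_norm].
- rewrite intE; last first.
    apply: (measurableT_comp (f := fun x : R => x `^ r)).
      exact: measurable_powR.
    exact: measurable_normF.
  rewrite lte_fin ltr_pwDr//.
  (* Since [q ^+ i * M >= 1], the exponent [r] may be raised to [rbar], which makes the estimate
     uniform in [r]. *)
  have bound i (a c : R) : 0 <= a <= q ^+ i -> 0 <= c <= M ->
      (a * c) `^ r <= M `^ rbar * (q `^ rbar) ^+ i.
    move=> /andP[a0 aq] /andP[c0 cM].
    have qi : 1 <= q ^+ i by rewrite exprn_ege1// le_max lexx.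
    have r0 : 0 <= r by rewrite (le_trans ler01).
    apply: (@le_trans _ _ ((q ^+ i * M) `^ r)).
      by rewrite ge0_ler_powR ?nnegrE ?ler_pM ?mulr_ge0// ltW// (lt_le_trans ltr01).
    apply: (@le_trans _ _ ((q ^+ i * M) `^ rbar)).
      by rewrite ler_powR ?(ltW rr)// mulr_ege1.
    rewrite powRM ?(le_trans ler01 qi) ?(le_trans ler01 M_ge1)// mulrC.
    rewrite -!powR_mulrn ?powR_ge0 ?(ltW q_gt0)//.
    by rewrite -!powRrM [_ * rbar]mulrC.
  have rhoq i : 0 <= rho ^+ i <= q ^+ i.
    rewrite exprn_ge0 ?(ltW rho_gt0)//= lerXn2r ?nnegrE ?(ltW rho_gt0) ?(ltW q_gt0)//.
    by rewrite le_max lexx orbT.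
  apply: (stair_sum_le p01' t01 k (f := fun B : 'M[R]_3 => normF B `^ r));
    rewrite ?powR_ge0//.
  + rewrite normFZ ?(ltW l1_gt0)//; have := bound 0%N 1 (l1 * normF S).
    by rewrite mul1r expr0 mulr1; apply; rewrite ?ler01 ?lexx ?l1S_ge0.
  + move=> i; rewrite /X normFZ ?exprn_ge0 ?(ltW rho_gt0)// normF_conj//.
    by apply: bound; rewrite ?rhoq ?T_ge0.
  + move=> i; rewrite /Y normFZ ?mulr_ge0 ?exprn_ge0 ?(ltW rho_gt0) ?(ltW l2_gt0)//.
    by rewrite normF_conj// -mulrA; apply: bound; rewrite ?rhoq ?l2S_ge0.
Qed.
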